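(* Let $M=\mathcal{M}(G,n,m;P)$ be a finite completely simple semigroup with sandwich matrix $P$. Then $M/\eta^{*}\cong G_{\eta^{*}}$.
   Context: For a semigroup $S$, $S^1$ denotes $S$ if $S$ has an identity, and $S$ with an identity $1$ adjoined otherwise. For $x,y,z_1,z_2,\ldots$ in $S^1$ define recursively $\lambda_0=x$, $\rho_0=y$, and $\lambda_{n+1}=\lambda_n z_{n+1}\rho_n$, $\rho_{n+1}=\rho_n z_{n+1}\lambda_n$, where $\lambda_n=\lambda_n(x,y,z_1,\ldots,z_n)$ and $\rho_n=\rho_n(x,y,z_1,\ldots,z_n)$. For a semigroup $S$ let $\eta_1=\{(x,x)\mid x\in S\}$ and, for every integer $n>1$, let $x\,\eta_n\,y$ if and only if there exist $z_1,\ldots,z_n\in S^1$ such that $x=\lambda_n(x,y,z_1,\ldots,z_n)$ and $y=\rho_n(x,y,z_1,\ldots,z_n)$. Let $\eta$ be the transitive closure of $\bigcup_{i\ge 1}\eta_i$, and let $\eta^{*}$ be the smallest congruence on $S$ containing $\eta$. For a finite group $G$, positive integers $n,m$ and an $m\times n$ matrix $P=(p_{ji})$ with all entries in $G$, $\mathcal{M}(G,n,m;P)$ is the semigroup of triples $(g;i,j)$ with $g\in G$, $1\le i\le n$, $1\le j\le m$ and product $(g;i,j)(h;k,l)=(gp_{jk}h;i,l)$. Every finite completely simple semigroup is of this form. $G/\eta^{*}$ is the quotient of the group $G$ by its own relation $\eta^{*}$ ($G$ regarded as a semigroup), and $G_{\eta^{*}}=(G/\eta^{*})/K$, where $K$ is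 the smallest normal subgroup of $G/\eta^{*}$ such that the images in $(G/\eta^* )/K$ of the entries of $P$ satisfy $$p_{x,c'}^{-1}p_{x,c}=p_{\beta,c'}^{-1}p_{\beta,c}\quad\text{and}\quad p_{d,y}p_{d',y}^{-1}=p_{d,\alpha}p_{d',\alpha}^{-1}$$ for all $c,c',\alpha,y\in\{1,\ldots,n\}$ and $\beta,x,d,d'\in\{1,\ldots,m\}$. *)

(* Defs.v *)
From HB Require Import structures.
From mathcomp Require Import all_boot all_fingroup matrix boolp.
From Stdlib Require Import Relation_Operators.

Set Implicit Arguments.
Unset Strict Implicit.
Unset Printing Implicit Defensive.

Local Open Scope group_scope.
Local Open Scope quotient_scope.

(* [repr] is shadowed by the coset representative of fingroup. *)
Local Notation rep := generic_quotient.repr.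

Section AdjoinOne.
Variable S : semigroupType.

Definition is_identity (e : S) : Prop :=
  left_id e *%g /\ right_id e *%g.

Definition has_identity : Prop := exists e : S, is_identity e.

(* [None] plays the role of the adjoined identity; it is only allowed when [S]
   has no identity of its own. *)
Definition adjoin1_pred : pred (option S) :=
  fun o => isSome o || ~~ `[< has_identity >].

Definition adjoin1 : Type := {o : option S | adjoin1_pred o}.

HB.instance Definition _ := Choice.on adjoin1.

Definition adjoin1_in (x : S) : adjoin1 := exist _ (Some x) isT.

Definition opt_mul (a b : option S) : option S :=
  match a, b with
  | Some x, Some y => Some (x * y)
  | None, _ => b
  | _, None => a
  end.

Lemma opt_mul_subproof (a b : adjoin1) :
  adjoin1_pred (opt_mul (val a) (val b)).
Proof. by case: a b => [[x|] hx] [[y|] hy]. Qed.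

Definition adjoin1_mul (a b : adjoin1) : adjoin1 :=
  exist _ (opt_mul (val a) (val b)) (opt_mul_subproof a b).

Lemma opt_one_subproof :
  {u : adjoin1 | left_id u adjoin1_mul /\ right_id u adjoin1_mul}.
Proof.
case: (pselect has_identity) => [h|h].
  have [e [le re]] := cid h.
  exists (adjoin1_in e); split => -[[x|] hx]; apply: val_inj => //=.
  - by rewrite le.
  - by case/negP: hx; apply/asboolP.
  - by rewrite re.
  - by case/negP: hx; apply/asboolP.
have hN : adjoin1_pred None by apply/negP => /asboolP.
by exists (exist _ None hN); split => -[[x|] hx]; apply: val_inj.
Qed.

Lemma adjoin1_mulA : associative adjoin1_mul.
Proof.
move=> [[x|] hx] [[y|] hy] [[z|] hz]; apply: val_inj => //=.
by rewrite mulgA.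
Qed.

HB.instance Definition _ := isMonoid.Build adjoin1 adjoin1_mulA
  (proj1 (svalP opt_one_subproof)) (proj2 (svalP opt_one_subproof)).

End AdjoinOne.

(* (lambda_n, rho_n) for n = size zs, with zs = [:: z_1; ...; z_n]. *)
Definition lambda_rho (T : semigroupType) (x y : T) (zs : seq T) : T * T :=
  foldl (fun lr z => (lr.1 * z * lr.2, lr.2 * z * lr.1)) (x, y) zs.

Definition lambda (T : semigroupType) (x y : T) (zs : seq T) : T :=
  (lambda_rho x y zs).1.

Definition rho (T : semigroupType) (x y : T) (zs : seq T) : T :=
  (lambda_rho x y zs).2.

Section Eta.
Variable S : semigroupType.

Definition eta_ (n : nat) (x y : S) : Prop :=
  if (n == 1)%N then x = y else
  exists zs : n.-tuple (adjoin1 S),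
    adjoin1_in x = lambda (adjoin1_in x) (adjoin1_in y) zs /\
    adjoin1_in y = rho (adjoin1_in x) (adjoin1_in y) zs.

Definition eta : S -> S -> Prop :=
  clos_trans S (fun x y => exists2 n : nat, (1 <= n)%N & eta_ n x y).

Definition congruence (R : S -> S -> Prop) : Prop :=
  [/\ forall x, R x x,
      forall x y, R x y -> R y x,
      forall x y z, R x y -> R y z -> R x z &
      forall a x y, R x y -> R (a * x) (a * y) /\ R (x * a) (y * a)].

Definition eta_star (x y : S) : Prop :=
  forall R : S -> S -> Prop, congruence R ->
    (forall a b, eta a b -> R a b) -> R x y.

Lemma eta_star_congruence : congruence eta_star.
Proof.
split.
- by move=> x R [].
- move=> x y h R cR sR; have [_ hs _ _] := cR; apply: hs; exact: h.
- move=> x y z h1 h2 R cR sR; have [_ _ ht _] := cR.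
  by apply: ht (h1 R cR sR) (h2 R cR sR).
- move=> a x y h; split=> R cR sR; have [_ _ _ hc] := cR;
  by case: (hc a x y (h R cR sR)).
Qed.

Lemma eta_star_of_eta (x y : S) : eta x y -> eta_star x y.
Proof. by move=> h R _; apply. Qed.

Definition eta_star_rel : rel S := fun x y => `[< eta_star x y >].

Lemma eta_star_refl : reflexive eta_star_rel.
Proof. by move=> x; apply/asboolP; have [h _ _ _] := eta_star_congruence. Qed.

Lemma eta_star_sym : symmetric eta_star_rel.
Proof.
have [_ h _ _] := eta_star_congruence.
by move=> x y; apply/asboolP/asboolP; apply: h.
Qed.

Lemma eta_star_trans : transitive eta_star_rel.
Proof.
have [_ _ h _] := eta_star_congruence.
by move=> y x z /asboolP hx /asboolP hy; apply/asboolP; apply: h hx hy.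
Qed.

Canonical eta_star_equiv : equiv_rel S :=
  EquivRel eta_star_rel eta_star_refl eta_star_sym eta_star_trans.

Definition eta_quot : Type := {eq_quot eta_star_equiv}.

HB.instance Definition _ := Choice.on eta_quot.
HB.instance Definition _ := EqQuotient.on eta_quot.

Definition eta_proj (x : S) : eta_quot := \pi_eta_quot x.

Lemma eta_projP (x y : S) : eta_proj x = eta_proj y <-> eta_star x y.
Proof.
by split=> [/eqP|h]; [|apply/eqP]; rewrite /eta_proj eqmodE => *; apply/asboolP.
Qed.

Definition eta_mul (a b : eta_quot) : eta_quot := eta_proj (rep a * rep b).

Lemma eta_mulE : {morph eta_proj : x y / x * y >-> eta_mul x y}.
Proof.
have [_ hs ht hc] := eta_star_congruence.
have hr x : eta_star (rep (eta_proj x)) x.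
  by apply/eta_projP; rewrite /eta_proj reprK.
move=> x y; apply/eta_projP; apply: hs.
apply: ht (proj1 (hc _ _ _ (hr y))).
exact: (proj2 (hc _ _ _ (hr x))).
Qed.

Lemma eta_projK (a : eta_quot) : exists x, a = eta_proj x.
Proof. by exists (rep a); rewrite /eta_proj reprK. Qed.

Lemma eta_mulA : associative eta_mul.
Proof.
move=> a b c; have [x ->] := eta_projK a; have [y ->] := eta_projK b.
by have [z ->] := eta_projK c; rewrite -!eta_mulE mulgA.
Qed.

HB.instance Definition _ := hasMul.Build eta_quot eta_mul.
HB.instance Definition _ := Magma_isSemigroup.Build eta_quot eta_mulA.

Lemma eta_projM : {morph eta_proj : x y / x * y}.
Proof. exact: eta_mulE. Qed.

End Eta.

Section EtaGroup.
Variable gT : finGroupType.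
Local Notation Q := (eta_quot gT).

HB.instance Definition _ : isCountable Q := CanIsCountable (@reprK _ Q).
HB.instance Definition _ : isFinite Q := CanIsFinite (@reprK _ Q).

Definition etag_one : Q := eta_proj (1 : gT).
Definition etag_inv (a : Q) : Q := eta_proj (rep a)^-1.

Lemma etag_mul1 : left_id etag_one *%g.
Proof. by move=> a; have [x ->] := eta_projK a; rewrite -eta_projM mul1g. Qed.

Lemma etag_mulr1 : right_id etag_one *%g.
Proof. by move=> a; have [x ->] := eta_projK a; rewrite -eta_projM mulg1. Qed.

HB.instance Definition _ := Magma_isUMagma.Build Q etag_mul1 etag_mulr1.
HB.instance Definition _ := hasInv.Build Q etag_inv.

Lemma etag_mulV : left_inverse 1 etag_inv *%g.
Proof. by move=> a; rewrite -{2}[a]reprK -eta_projM mulVg. Qed.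

Lemma etag_mulrV : right_inverse 1 etag_inv *%g.
Proof. by move=> a; rewrite -{1}[a]reprK -eta_projM mulgV. Qed.

HB.instance Definition _ := Monoid_isGroup.Build Q etag_mulV etag_mulrV.

End EtaGroup.

(* [P] does not occur in the body: it selects the multiplication below. *)
Definition rees (gT : finGroupType) (n m : nat) (P : 'M[gT]_(m, n)) : Type :=
  (gT * 'I_n * 'I_m)%type.

Section Rees.
Variables (gT : finGroupType) (n m : nat) (P : 'M[gT]_(m, n)).

HB.instance Definition _ := Finite.on (rees P).

Definition rees_mul (a b : rees P) : rees P :=
  let: (g, i, j) := a in let: (h, k, l) := b in (g * P j k * h, i, l).

Lemma rees_mulA : associative rees_mul.
Proof. by move=> [[g i] j] [[h k] l] [[u r] s] /=; rewrite !mulgA. Qed.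

HB.instance Definition _ := isSemigroup.Build (rees P) rees_mulA.

End Rees.

Section GEta.
Variables (gT : finGroupType) (n m : nat) (P : 'M[gT]_(m, n)).
Local Notation Q := (eta_quot gT).

Definition sandwich_rel (N : {group Q}) : bool :=
  let p (j : 'I_m) (i : 'I_n) := coset N (eta_proj (P j i)) in
  [forall x : 'I_m, forall beta : 'I_m, forall c : 'I_n, forall c' : 'I_n,
     (p x c')^-1 * p x c == (p beta c')^-1 * p beta c] &&
  [forall d : 'I_m, forall d' : 'I_m, forall y : 'I_n, forall alpha : 'I_n,
     p d y * (p d' y)^-1 == p d alpha * (p d' alpha)^-1].

Definition sandwich_ker : {group Q} :=
  [group of \bigcap_(N : {group Q} | (N <| [set: Q]) && sandwich_rel N) N].

Lemma sandwich_relP (N : {group Q}) : N <| [set: Q] ->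
  reflect
    ((forall (x beta : 'I_m) (c c' : 'I_n),
        (eta_proj (P x c'))^-1 * eta_proj (P x c) *
        ((eta_proj (P beta c'))^-1 * eta_proj (P beta c))^-1 \in N) /\
     (forall (d d' : 'I_m) (y alpha : 'I_n),
        eta_proj (P d y) * (eta_proj (P d' y))^-1 *
        (eta_proj (P d alpha) * (eta_proj (P d' alpha))^-1)^-1 \in N))
    (sandwich_rel N).
Proof.
move=> /andP[_ nN].
have nNx (x : Q) : x \in 'N(N) by apply: (subsetP nN); rewrite inE.
have cM (x y : Q) : coset N (x * y) = coset N x * coset N y.
  by rewrite morphM.
have cV (x : Q) : coset N x^-1 = (coset N x)^-1 by rewrite morphV.
have E (x y : Q) : (coset N x == coset N y) = (x * y^-1 \in N).
  by rewrite eq_mulgV1 -cV -cM; apply/eqP/idP; [exact: coset_idr | exact: coset_id].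
apply: (iffP andP) => -[h1 h2]; split.
- move=> x b c c'; move/forallP/(_ x)/forallP/(_ b)/forallP/(_ c)/forallP/(_ c'): h1.
  by rewrite -!cV -!cM E.
- move=> x b c c'; move/forallP/(_ x)/forallP/(_ b)/forallP/(_ c)/forallP/(_ c'): h2.
  by rewrite -!cV -!cM E.
- apply/forallP => x; apply/forallP => b; apply/forallP => c; apply/forallP => c'.
  by rewrite -!cV -!cM E.
- apply/forallP => x; apply/forallP => b; apply/forallP => c; apply/forallP => c'.
  by rewrite -!cV -!cM E.
Qed.

Lemma sandwich_ker_normal : sandwich_ker <| [set: Q].
Proof.
rewrite /normal subsetT; apply/normsP => x _ /=; apply/setP => y.
rewrite mem_conjg; apply/bigcapP/bigcapP => h N hN;
  have /andP[/andP[_ nN] _] := hN; have nNx := subsetP nN x (in_setT x);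
  have := h N hN; first by rewrite memJ_norm // groupV.
by rewrite memJ_norm // groupV.
Qed.

Lemma sandwich_ker_rel : sandwich_rel sandwich_ker.
Proof.
apply/(sandwich_relP sandwich_ker_normal); split=> *;
  by apply/bigcapP => N /andP[nN /(sandwich_relP nN)[h1 h2]].
Qed.

Lemma sandwich_ker_min (N : {group Q}) :
  N <| [set: Q] -> sandwich_rel N -> sandwich_ker \subset N.
Proof. by move=> nN rN; apply: bigcap_inf; rewrite nN. Qed.

Definition G_eta : finGroupType := coset_of sandwich_ker.

End GEta.

(* Main.v *)
(* The quotient [G_eta] inherits the triviality of eta from G/eta*: a cyclic
   (lambda, rho) pair in a quotient of a finite semigroup lifts to a cyclic
   pair, since the orbit of any lift is ultimately periodic.  Hence
   (g; i, j) |-> b_i g a_j, where a_j b_i = p_ji is the rank-one factorization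
   of the sandwich matrix in [G_eta], is constant on eta*-classes.  Conversely,
   two idempotents e, f of M in the same row or column satisfy ef = e, fe = f
   or ef = f, fe = e, hence are eta_2-related; so (g; i, j) is eta*-related to
   the element of the maximal subgroup at (i0, j0) with coordinate b_i g a_j,
   and in M/eta* the matrix entries factor as a_j b_i, so that the map
   G -> M/eta* kills [sandwich_ker]. *)
From HB Require Import structures.
From mathcomp Require Import all_boot all_fingroup matrix boolp.
From Stdlib Require Import Relation_Operators.
Require Import Defs.

Set Implicit Arguments.
Unset Strict Implicit.
Unset Printing Implicit Defensive.

Local Open Scope group_scope.

(** * Lambda-rho sequences under morphisms and iteration *)

Lemma lambda_rho_morph (S T : semigroupType) (f : S -> T)
    (fM : {morph f : x y / x * y}) (x y : S) (zs : seq S) :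
  lambda_rho (f x) (f y) (map f zs) =
  (f (lambda_rho x y zs).1, f (lambda_rho x y zs).2).
Proof.
by elim: zs x y => [|z zs IH] x y //=; rewrite /lambda_rho /= -!fM; apply: IH.
Qed.

(** Turns a cycle of the map [lambda_rho _ _ zs] on pairs into one long closed sequence. *)
Lemma lambda_rho_flatten_nseq (S : semigroupType) (zs : seq S) (k : nat)
    (x y : S) :
  lambda_rho x y (flatten (nseq k zs)) =
  iter k (fun p => lambda_rho p.1 p.2 zs) (x, y).
Proof.
elim: k x y => [|k IH] x y //; rewrite iterSr -[nseq _ _]/(zs :: _) /=.
rewrite {1}/lambda_rho foldl_cat -/(lambda_rho x y zs).
by case: (lambda_rho x y zs) => a b; apply: IH.
Qed.

Lemma iter_recurrent (T : finType) (f : T -> T) (x : T) :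
  exists k l, 0 < l /\ iter l f (iter k f x) = iter k f x.
Proof.
have /trajectP[k klt E] := looping_order f x.
exists k, (fingraph.order f x - k); rewrite subn_gt0 klt -iterD subnK ?E //.
exact: ltnW.
Qed.

(** The bound avoids length 1, where [eta_] is plain equality. *)
Lemma eta_of_lambda_rho (S : semigroupType) (x y : S) (zs : seq S) :
  1 < size zs -> lambda_rho x y zs = (x, y) -> eta x y.
Proof.
move=> sz E; apply: t_step; exists (size zs); first exact: ltnW.
rewrite /eta_ gtn_eqF //.
have sM : size (map (@adjoin1_in S) zs) == size zs by rewrite size_map.
have iM : {morph @adjoin1_in S : a b / a * b} by move=> a b; apply: val_inj.
by exists (Tuple sM); rewrite /lambda /rho /= lambda_rho_morph // E.
Qed.

Definition adjoin1_ext (S : semigroupType) (T : monoidType) (f : S -> T)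
  (a : adjoin1 S) : T := oapp f 1 (val a).

Lemma adjoin1_extM (S : semigroupType) (T : monoidType) (f : S -> T)
    (fM : {morph f : x y / x * y}) :
  {morph adjoin1_ext f : a b / a * b}.
Proof.
by case=> [[x|] hx] [[y|] hy]; rewrite /adjoin1_ext /= ?fM ?mul1g ?mulg1.
Qed.

Lemma eta_morph (S : semigroupType) (T : monoidType) (f : S -> T)
    (fM : {morph f : x y / x * y}) (n : nat) (x y : S) :
    0 < n -> eta_ n x y ->
  x = y \/
  exists2 zs : seq T, 1 < size zs & lambda_rho (f x) (f y) zs = (f x, f y).
Proof.
rewrite /eta_; case: eqP => [_ _|/eqP n1 n0]; first by left.
case=> zs [ex ey]; right; exists (map (adjoin1_ext f) zs).
  by rewrite size_map size_tuple ltn_neqAle eq_sym n1.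
have := lambda_rho_morph (adjoin1_extM fM) (adjoin1_in x) (adjoin1_in y) zs.
rewrite -/(lambda (adjoin1_in x) (adjoin1_in y) zs).
by rewrite -/(rho (adjoin1_in x) (adjoin1_in y) zs) -ex -ey.
Qed.

(* A cyclic pair [(u, v)] of [T] lifts to a pair whose orbit under the lifted
   step stays over [(u, v)] and, [G] being finite, reaches a cyclic pair. *)
Lemma eq_of_lambda_rho (gT : finGroupType) (T : semigroupType) (f : gT -> T)
    (fM : {morph f : x y / x * y}) (f_surj : forall t, exists x, f x = t)
    (f_eta : forall x y, eta x y -> f x = f y) (u v : T) (zs : seq T) :
  1 < size zs -> lambda_rho u v zs = (u, v) -> u = v.
Proof.
move=> sz E; have [g gK] := choice f_surj.
pose ws := map g zs; pose step p := lambda_rho p.1 p.2 ws.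
pose p k := iter k step (g u, g v).
have fp k : (f (p k).1, f (p k).2) = (u, v).
  elim: k => [|k IH]; first by rewrite /= !gK.
  rewrite -[p _]/(step (p k)) /step -lambda_rho_morph //.
  have fws : map f ws = zs by rewrite -map_comp map_id_in // => t _ /=.
  by case: IH => -> ->; rewrite fws.
have [k [l [l0 pkl]]] := iter_recurrent step (g u, g v).
case: (fp k) => <- <-; apply: f_eta.
apply: (@eta_of_lambda_rho _ _ _ (flatten (nseq l ws))).
  rewrite size_flatten /shape map_nseq sumn_nseq size_map.
  exact: leq_trans sz (leq_pmulr _ l0).
by rewrite lambda_rho_flatten_nseq -surjective_pairing.
Qed.

(** * Morphisms compatible with eta* *)

Lemma eta_star_morph (S T : semigroupType) (f : S -> T)
    (fM : {morph f : x y / x * y}) :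
    (forall n x y, 0 < n -> eta_ n x y -> f x = f y) ->
  forall x y, eta_star x y -> f x = f y.
Proof.
(* The kernel relation of [f] is a congruence, so it contains eta* once it contains eta. *)
move=> f_eta x y /(_ (fun a b => f a = f b)); apply; last first.
  by move=> a b; elim=> [c d [n n0 /(f_eta _ _ _ n0)]|c d e _ -> _ ->].
by split=> // [a b c -> ->|a b c E] //; rewrite !fM E.
Qed.

Lemma eta_proj_eta (S : semigroupType) (x y : S) :
  eta x y -> eta_proj x = eta_proj y.
Proof. by move=> /eta_star_of_eta/eta_projP. Qed.

Definition eta_lift (S T : semigroupType) (f : S -> T) (q : eta_quot S) : T :=
  f (generic_quotient.repr q).

Lemma eta_lift_proj (S T : semigroupType) (f : S -> T) :
    (forall x y, eta_star x y -> f x = f y) ->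
  forall x, eta_lift f (eta_proj x) = f x.
Proof.
move=> f_eta x; apply: f_eta; apply/eta_projP.
by rewrite /eta_proj generic_quotient.reprK.
Qed.

Lemma eta_liftM (S T : semigroupType) (f : S -> T)
    (fM : {morph f : x y / x * y}) :
    (forall x y, eta_star x y -> f x = f y) ->
  {morph eta_lift f : a b / a * b}.
Proof.
move=> f_eta a b; have [x ->] := eta_projK a; have [y ->] := eta_projK b.
by rewrite -eta_projM !eta_lift_proj.
Qed.

Lemma eta_projV (gT : finGroupType) (x : gT) :
  eta_proj x^-1 = (eta_proj x)^-1.
Proof. by apply: (mulIg (eta_proj x)); rewrite mulVg -eta_projM mulVg. Qed.

Section MorphismOnGroup.
Variables (gT : finGroupType) (T : semigroupType) (f : gT -> T).
Hypothesis fM : {morph f : x y / x * y}.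

(** [T] is only a semigroup, so inverses are compared through [f 1], an identity on the image of
    [f]. *)
Lemma morphV_eq (x y : gT) : f x = f y -> f x^-1 = f y^-1.
Proof.
move=> E; rewrite -[x^-1]mulg1 -(mulgV y) mulgA fM (fM x^-1) -E -fM mulVg.
by rewrite -fM mul1g.
Qed.

Lemma morphVMr_eq (x y : gT) : (f (x * y^-1) = f 1) <-> (f x = f y).
Proof.
split=> E; first by rewrite -[x in LHS](mulgKV y) fM E -fM mul1g.
by rewrite fM E -fM mulgV.
Qed.

Definition morph_ker : {set gT} := [set x | `[< f x = f 1 >]].

Lemma morph_kerP (x : gT) : reflect (f x = f 1) (x \in morph_ker).
Proof. by rewrite inE; apply: asboolP. Qed.

Lemma morph_ker_group_set : group_set morph_ker.
Proof.
apply/group_setP; split; first exact/morph_kerP.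
move=> x y /morph_kerP fx /morph_kerP fy.
by apply/morph_kerP; rewrite fM fx fy -fM mulg1.
Qed.

Canonical morph_ker_group := Group morph_ker_group_set.

Lemma morph_ker_normal : morph_ker <| [set: gT].
Proof.
rewrite /normal subsetT; apply/subsetP => x _; rewrite inE.
apply/subsetP => _ /imsetP[y /morph_kerP fy ->]; apply/morph_kerP.
by rewrite /conjg !fM fy -!fM mul1g mulVg.
Qed.

End MorphismOnGroup.

(** * The morphism from M to [G_eta] *)

Section ReesQuotient.
Variables (gT : finGroupType) (n m : nat) (P : 'M[gT]_(m, n)).
Variables (i0 : 'I_n) (j0 : 'I_m).
Local Notation M := (rees P).
Local Notation N := (sandwich_ker P).

Lemma rees_mulE (g h : gT) (i k : 'I_n) (j l : 'I_m) :
  ((g, i, j) : M) * ((h, k, l) : M) = (g * P j k * h, i, l).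
Proof. by []. Qed.

Lemma in_norm_sandwich_ker (q : eta_quot gT) : q \in 'N(N).
Proof.
by apply: (subsetP (normal_norm (sandwich_ker_normal P))); rewrite inE.
Qed.

Definition to_G_eta (x : gT) : G_eta P := coset N (eta_proj x).

Lemma to_G_etaM : {morph to_G_eta : x y / x * y}.
Proof.
move=> x y; rewrite /to_G_eta eta_projM.
by rewrite morphM ?in_norm_sandwich_ker.
Qed.

Lemma to_G_eta_surj (t : G_eta P) : exists x, to_G_eta x = t.
Proof.
have [q _ ->] := cosetP t; have [x ->] := eta_projK q.
by exists x.
Qed.

Lemma to_G_eta_eta (x y : gT) : eta x y -> to_G_eta x = to_G_eta y.
Proof. by rewrite /to_G_eta => /eta_proj_eta ->. Qed.

(* In [G_eta] the sandwich matrix has rank one: p_ji = a_j * b_i with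
   a_j = p_(j, i0) and b_i = p_(j0, i0)^-1 * p_(j0, i). *)
Definition rees_coord (x : M) : gT :=
  let: (g, i, j) := x in (P j0 i0)^-1 * P j0 i * g * P j i0.

Lemma to_G_eta_sandwich (j : 'I_m) (i : 'I_n) :
  to_G_eta (P j i) = to_G_eta (P j i0 * ((P j0 i0)^-1 * P j0 i)).
Proof.
(* The first family of relations, at rows [j], [j0] and columns [i], [i0]. *)
have /andP[/forallP/(_ j)/forallP/(_ j0) H0 _] := sandwich_ker_rel P.
move: H0 => /forallP/(_ i)/forallP/(_ i0)/eqP H.
have cV x : (coset N (eta_proj x))^-1 = to_G_eta x^-1.
  by rewrite /to_G_eta eta_projV morphV ?in_norm_sandwich_ker.
move: H; rewrite !cV -!/(to_G_eta _) -!to_G_etaM => H.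
by rewrite to_G_etaM -H -to_G_etaM mulKVg.
Qed.

Definition rees_to_G_eta (x : M) : G_eta P := to_G_eta (rees_coord x).

Lemma rees_to_G_etaM : {morph rees_to_G_eta : x y / x * y}.
Proof.
move=> [[g i] j] [[h k] l]; rewrite /rees_to_G_eta -to_G_etaM.
rewrite -[rees_coord _]/(_ * (g * P j k * h) * _).
by rewrite !to_G_etaM (to_G_eta_sandwich j k) !to_G_etaM !mulgA.
Qed.

Lemma rees_to_G_eta_eta_star (x y : M) :
  eta_star x y -> rees_to_G_eta x = rees_to_G_eta y.
Proof.
apply: eta_star_morph => [|k {}x {}y k0]; first exact: rees_to_G_etaM.
case/(eta_morph rees_to_G_etaM k0) => [->//|[zs sz E]].
exact: eq_of_lambda_rho to_G_etaM to_G_eta_surj to_G_eta_eta _ _ _ sz E.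
Qed.

(** * Idempotents of M and the map from G to M/eta* *)

Definition rees_idem (i : 'I_n) (j : 'I_m) : M := ((P j i)^-1, i, j).

Lemma eta_rees_idem_row (i i' : 'I_n) (j : 'I_m) :
  eta (rees_idem i j) (rees_idem i' j).
Proof.
(* For these idempotents ef = e and fe = f, so z = e fixes the pair (e, f); two copies give the
   length eta requires. *)
apply: (@eta_of_lambda_rho _ _ _ (nseq 2 (rees_idem i j))) => //.
by rewrite /lambda_rho /= /rees_idem !rees_mulE !(mulgK, mulgKV, mulVg, mul1g).
Qed.

Lemma eta_rees_idem_col (i : 'I_n) (j j' : 'I_m) :
  eta (rees_idem i j) (rees_idem i j').
Proof.
(* Here ef = f and fe = e, so z = e swaps the pair and the second copy swaps it back. *)
apply: (@eta_of_lambda_rho _ _ _ (nseq 2 (rees_idem i j))) => //.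
by rewrite /lambda_rho /= /rees_idem !rees_mulE !(mulgK, mulgKV, mulVg, mul1g).
Qed.

(** Identifies G with the maximal subgroup at [(i0, j0)]; the inverse entry cancels the sandwich
    factor in products. *)
Definition rees_in (x : gT) : M := (x * (P j0 i0)^-1, i0, j0).

Lemma rees_inM : {morph rees_in : x y / x * y}.
Proof. by move=> x y; rewrite /rees_in rees_mulE mulgKV mulgA. Qed.

Definition group_to_quot (x : gT) : eta_quot M := eta_proj (rees_in x).

Lemma group_to_quotM : {morph group_to_quot : x y / x * y}.
Proof. by move=> x y; rewrite /group_to_quot rees_inM eta_projM. Qed.

(** Write x = exe with e the idempotent at the position of x; modulo eta*, e becomes the idempotent
    at [(i0, j0)] and the product becomes [rees_in (rees_coord x)]. *)
Lemma group_to_quot_coord (x : M) :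
  group_to_quot (rees_coord x) = eta_proj x.
Proof.
case: x => [[g i] j].
have idem i1 j1 : eta_proj (rees_idem i1 j1) = eta_proj (rees_idem i0 j0).
  transitivity (eta_proj (rees_idem i1 j0)); apply: eta_proj_eta.
    exact: eta_rees_idem_col.
  exact: eta_rees_idem_row.
pose e := rees_idem i j.
have E : (g, i, j) = e * (g, i, j) * e :> M.
  by rewrite !rees_mulE mulVg mul1g mulgK.
rewrite [in RHS]E !eta_projM idem -!eta_projM; congr eta_proj.
Qed.

Lemma group_to_quot_sandwich (j : 'I_m) (i : 'I_n) :
  group_to_quot (P j i) =
  group_to_quot (P j i0 * ((P j0 i0)^-1 * P j0 i)).
Proof.
(* The coordinates of [x * y], [x] and [y] turn multiplicativity into the claim multiplied by
   [P j0 i0] on the right. *)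
pose x : M := (1, i0, j); pose y : M := (1, i, j0).
have H : group_to_quot (rees_coord (x * y)) =
    group_to_quot (rees_coord x * rees_coord y).
  by rewrite group_to_quotM !group_to_quot_coord eta_projM.
move: H; rewrite /= !mulVg !mul1g !mulg1 => H.
move: (congr1 (fun q => q * group_to_quot (P j0 i0)^-1) H).
by rewrite -!group_to_quotM !mulgA !mulgK.
Qed.

Lemma group_to_quot_eta_star (x y : gT) :
  eta_star x y -> group_to_quot x = group_to_quot y.
Proof.
apply: eta_star_morph => [|k {}x {}y k0]; first exact: group_to_quotM.
(* G has an identity, so [id] brings the z's from G^1 back into G; [rees_in] then carries them to
   M. *)
have idM : {morph @id gT : a b / a * b} by [].
case/(eta_morph idM k0) => [->//|[zs sz E]].
apply: eta_proj_eta.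
apply: (@eta_of_lambda_rho _ _ _ (map rees_in zs)); first by rewrite size_map.
by rewrite (lambda_rho_morph rees_inM) E.
Qed.

Definition eta_group_to_quot : eta_quot gT -> eta_quot M :=
  eta_lift group_to_quot.

Lemma eta_group_to_quotM : {morph eta_group_to_quot : a b / a * b}.
Proof. exact: eta_liftM group_to_quotM group_to_quot_eta_star. Qed.

(** By minimality it is enough that the kernel on the right satisfies the sandwich relations, which
    follow from the factorization in M/eta*. *)
Lemma sandwich_ker_sub : N \subset morph_ker eta_group_to_quot.
Proof.
pose K := morph_ker_group eta_group_to_quotM.
have nK : K <| setT := morph_ker_normal eta_group_to_quotM.
apply: (@sandwich_ker_min _ _ _ _ K nK).
have E x : eta_group_to_quot (eta_proj x) = group_to_quot x.
  exact: eta_lift_proj group_to_quot_eta_star _.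
have sV j i := morphV_eq group_to_quotM (group_to_quot_sandwich j i).
have s := group_to_quot_sandwich.
apply/(sandwich_relP _ nK); split=> [x b c c'|d d' y a];
  apply/morph_kerP/(morphVMr_eq eta_group_to_quotM);
  rewrite -!eta_projV -!eta_projM !E !group_to_quotM.
- by rewrite !sV !(s _ c) -!group_to_quotM !invMg -!mulgA !mulKg.
- by rewrite !sV !(s d) -!group_to_quotM !invMg -!mulgA !mulKVg.
Qed.

(** * Mutually inverse maps between M/eta* and [G_eta] *)

Definition from_G_eta (t : G_eta P) : eta_quot M := eta_group_to_quot (repr t).

(** The chosen representative differs from [eta_proj x] by an element of [N], which
    [eta_group_to_quot] kills. *)
Lemma from_G_eta_proj (x : gT) : from_G_eta (to_G_eta x) = group_to_quot x.
Proof.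
rewrite -(eta_lift_proj group_to_quot_eta_star) -/eta_group_to_quot.
apply/(morphVMr_eq eta_group_to_quotM)/morph_kerP/(subsetP sandwich_ker_sub).
rewrite -mem_rcoset; have /= := repr_coset_norm (to_G_eta x).
by rewrite -(val_coset (in_norm_sandwich_ker (eta_proj x))) mem_repr_coset.
Qed.

Definition quot_to_G_eta : eta_quot M -> G_eta P := eta_lift rees_to_G_eta.

Lemma quot_to_G_etaM : {morph quot_to_G_eta : a b / a * b}.
Proof. exact: eta_liftM rees_to_G_etaM rees_to_G_eta_eta_star. Qed.

Lemma quot_to_G_etaK : cancel quot_to_G_eta from_G_eta.
Proof.
move=> q; have [x ->] := eta_projK q.
rewrite /quot_to_G_eta eta_lift_proj; last exact: rees_to_G_eta_eta_star.
by rewrite from_G_eta_proj group_to_quot_coord.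
Qed.

Lemma from_G_etaK : cancel from_G_eta quot_to_G_eta.
Proof.
move=> t; have [x <-] := to_G_eta_surj t.
rewrite from_G_eta_proj /quot_to_G_eta eta_lift_proj.
  (* [rees_coord (rees_in x)] reduces to [x]. *)
  by rewrite /rees_to_G_eta /= mulVg mul1g mulgKV.
exact: rees_to_G_eta_eta_star.
Qed.

HB.instance Definition _ :=
  isMultiplicative.Build (eta_quot M) (G_eta P) quot_to_G_eta quot_to_G_etaM.

End ReesQuotient.

Theorem corollary2p4 (gT : finGroupType) (n m : nat)
    (n_gt0 : 0 < n) (m_gt0 : 0 < m) (P : 'M[gT]_(m, n)) :
  exists f : {multiplicative eta_quot (rees P) -> G_eta P}, bijective f.
Proof.
pose i0 := Ordinal n_gt0; pose j0 := Ordinal m_gt0.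
exists (@quot_to_G_eta gT n m P i0 j0).
exists (@from_G_eta gT n m P i0 j0); [exact: quot_to_G_etaK|exact: from_G_etaK].
Qed.
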